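(* Let $d\ge 2$ be an integer. Then there is a constant $C_d>0$, depending only on $d$, such that $$P_d(T,R)\le C_d\,R^{-d}\qquad\text{for all real } T\ge 1 \text{ and all real } R>0 .$$ Furthermore, for all real $T\ge 1$ and $R>0$, $$P_d(T,R)=0\quad\text{whenever}\quad R>\frac{\sqrt d}{2}\,T^{1/d}.$$
   Context: Let $\widehat{\mathbb N}^{d+1}$ be the set of vectors $\boldsymbol a=(a_1,\dots,a_{d+1})$ with positive integer entries and $\gcd(a_1,\dots,a_{d+1})=1$. Let $$\mathcal D_{d+1}=\Big\{(x_1,\dots,x_{d+1})\in\mathbb R_{\ge 0}^{d+1}:\ \max_{1\le j\le d}x_j<x_{d+1}\le 1\Big\}.$$ For $\boldsymbol a=(p_1,\dots,p_d,q)\in\widehat{\mathbb N}^{d+1}$ put $\boldsymbol\nu=(p_1/q,\dots,p_d/q)^T$ and let $L_{\boldsymbol a}=\mathbb Z^d+\mathbb Z\boldsymbol\nu\subset\mathbb R^d$, which is a lattice of rank $d$. For a lattice $L\subset\mathbb R^d$ of rank $d$, the covering radius is $\tau(L)=\inf\{\sigma>0: L+\sigma B=\mathbb R^d\}$, where $B$ is the closed Euclidean unit ball of $\mathbb R^d$ centred at the origin. For $T\ge 1$ and $R>0$ define $$P_d(T,R)=\frac{\#\{\boldsymbol a\in\widehat{\mathbb N}^{d+1}\cap T\mathcal D_{d+1}:\ \tau(L_{\boldsymbol a})\,a_{d+1}^{1/d}>R\}}{\#(\widehat{\mathbb N}^{d+1}\cap T\mathcal D_{d+1})},$$ with the convention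 that $P_d(T,R)=0$ if the set $\widehat{\mathbb N}^{d+1}\cap T\mathcal D_{d+1}$ is empty (which happens exactly when $1\le T<2$). *)

(* Defs.v *)
From mathcomp Require Import all_boot all_order all_algebra finmap.
From mathcomp Require Import all_classical all_reals all_analysis.
Set Implicit Arguments.
Unset Strict Implicit.
Unset Printing Implicit Defensive.
Import Order.TTheory GRing.Theory Num.Theory.
Local Open Scope classical_set_scope.
Local Open Scope ring_scope.

Definition primitive_vectors (n : nat) : set 'rV[nat]_n :=
  [set a : 'rV[nat]_n | (forall i, (0 < a 0%R i)%N) /\
     \big[gcdn/0%N]_(i < n) a 0 i = 1%N].

(* The last of the [d.+1] coordinates has index [ord_max]; the j-th of the
   first [d] ones has index [widen_ord (leqnSn d) j]. *)
Definition domainD (R : realType) (d : nat) : set 'rV[R]_d.+1 :=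
  [set x : 'rV[R]_d.+1 | (forall i, 0 <= x 0 i) /\
           (forall j : 'I_d, x 0 (widen_ord (leqnSn d) j) < x 0 ord_max) /\
           x 0 ord_max <= 1].

Definition dilate (R : realType) (n : nat) (T : R) (A : set 'rV[R]_n) :
    set 'rV[R]_n :=
  [set T *: x | x in A].

Definition primitive_in (R : realType) (d : nat) (T : R) : set 'rV[nat]_d.+1 :=
  [set a : 'rV[nat]_d.+1 | primitive_vectors a /\
           dilate T (@domainD R d) (map_mx (fun k : nat => k%:R) a)].

Definition nu (R : realType) (d : nat) (a : 'rV[nat]_d.+1) : 'rV[R]_d :=
  \row_j ((a 0 (widen_ord (leqnSn d) j))%:R / (a 0 ord_max)%:R).

Definition latticeL (R : realType) (d : nat) (a : 'rV[nat]_d.+1) :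
    set 'rV[R]_d :=
  [set map_mx intr z + nu R a *~ k | z in [set: 'rV[int]_d] & k in [set: int]].

(* The library norm on matrices is the sup norm, hence this definition. *)
Definition euclidean_norm (R : realType) (n : nat) (x : 'rV[R]_n) : R :=
  Num.sqrt (\sum_i x 0 i ^+ 2).

Definition unit_ballB (R : realType) (n : nat) : set 'rV[R]_n :=
  [set x : 'rV[R]_n | euclidean_norm x <= 1].

(* [inf] is real-valued, with value 0 on sets that are empty or not bounded
   below; [latticeL_cover_has_inf] below excludes this case for [latticeL]. *)
Definition covering_radius (R : realType) (n : nat) (L : set 'rV[R]_n) : R :=
  inf [set s : R | 0 < s /\
    [set v + w | v in L & w in dilate s (@unit_ballB R n)] = [set: 'rV[R]_n]].

(* [fset_set] is empty on infinite sets; [primitive_in_finite] below excludes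
   this case.  Division by zero yields 0, so P T r = 0 when the denominator
   vanishes. *)
Definition probP (R : realType) (d : nat) (T r : R) : R :=
  #|` fset_set [set a : 'rV[nat]_d.+1 | primitive_in T a /\
       covering_radius (@latticeL R d a) * (a 0 ord_max)%:R `^ (d%:R^-1) > r]|%:R
  / #|` fset_set (@primitive_in R d T)|%:R.

Lemma primitive_in_finite (R : realType) (d : nat) (T : R) :
  0 <= T -> finite_set (@primitive_in R d T).
Proof.
move=> T0; set N := Num.Def.truncn T.
apply: (@sub_finite_set _ _
  ((fun f : {ffun 'I_d.+1 -> 'I_N.+1} => \row_i (f i : nat)) @` setT)); last first.
  exact/finite_image/finite_finset.
move=> a [_ [x [x0 [xlt x1]] xa]].
have aN i : (a 0%R i < N.+1)%N.
  have xi : x 0 i <= 1.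
    case: (unliftP ord_max i) => [j|->//] ij.
    apply: le_trans x1; apply: ltW.
    by have := xlt j; congr (x 0 _ < _); apply/val_inj; rewrite ij /= /bump leqNgt ltn_ord.
  rewrite ltnS truncn_ge_nat//.
  have -> : (a 0 i)%:R = T * x 0 i :> R.
    by have := congr1 (fun m : 'rV[R]_d.+1 => m 0 i) xa; rewrite !mxE.
  by rewrite ler_piMr.
exists [ffun i => Ordinal (aN i)] => //.
by apply/rowP => i; rewrite mxE ffunE.
Qed.

Lemma latticeL_cover_has_inf (R : realType) (d : nat) (a : 'rV[nat]_d.+1) :
  has_inf [set s : R | 0 < s /\
    [set v + w | v in @latticeL R d a & w in dilate s (@unit_ballB R d)]
      = [set: 'rV[R]_d]].
Proof.
split; last by exists 0 => s [/ltW].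
have s0 : 0 < d%:R + 1 :> R by rewrite ltr_wpDl.
exists (d%:R + 1); split=> //; apply/seteqP; split=> // x _.
pose z : 'rV[int]_d := map_mx Num.floor x.
exists (map_mx intr z); first by exists z => //; exists 0 => //; rewrite mulr0z addr0.
exists (x - map_mx intr z); last by rewrite addrC subrK.
exists ((d%:R + 1)^-1 *: (x - map_mx intr z)); last first.
  by rewrite scalerA divff ?scale1r// gt_eqF.
rewrite /unit_ballB /= /euclidean_norm -[leRHS]sqrtr1 ler_wsqrtr//.
apply: (@le_trans _ _ (\sum_(i < d) (d%:R + 1)^-1)); last first.
  by rewrite sumr_const card_ord -[_ *+ d]mulr_natl ler_pdivrMr// mul1r lerDl.
apply: ler_sum => i _; rewrite !mxE.
set y := x 0 i - _.
have y0 : 0 <= y by rewrite subr_ge0 floor_le.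
have y1 : y <= 1 by rewrite lerBlDl ltW// -[1]/(1%:~R) -intrD floorD1_gt.
have V0 : 0 <= (d%:R + 1)^-1 :> R by rewrite invr_ge0 ltW.
have V1 : (d%:R + 1)^-1 <= 1 :> R by rewrite invf_le1// lerDr.
rewrite exprMn; apply: (@le_trans _ _ ((d%:R + 1)^-1 ^+ 2)).
  by rewrite ler_piMr ?exprn_ge0 ?exprn_ile1.
by rewrite expr2 ler_piMr.
Qed.

(* Main.v *)
Require Import Defs.
From mathcomp Require Import all_boot all_order all_algebra.
From mathcomp Require Import all_classical all_reals all_analysis.
From mathcomp Require Import finmap zify ring lra finset.
Import Order.TTheory GRing.Theory Num.Theory.
Local Open Scope ring_scope.

(** A covering radius that is large compared with the mean spacing q^(-1/d) of
    the lattice L_a forces a short nonzero integer vector m with q dividing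
    m.p, i.e. a short vector of the dual lattice of L_a; such vectors a lie on
    few hyperplanes and can be counted.

    The transference step ([close_lattice_point]) is a discrete uncertainty
    principle.  Write e(t) for exp (2 pi i t).  Fix x and consider the points
    y_k = x - k p/q of the torus, for k < q.  If there is no nonzero m with
    entries at most 2h in absolute value and q dividing m.p, then the characters
    e(J.y) with J in {0..2h}^d are orthogonal on these q points
    ([sum_cos_arith]), so Parseval holds for trigonometric polynomials S with
    frequencies in that box ([sum_energy_orthogonal]).  Let S have the tensor
    product of tent functions as coefficients.  Multiplying S by 1 - e(y_i)
    takes a discrete derivative of the coefficients in direction i
    ([shift_energy]), which shrinks the energy by a factor of order h^(-2)
    ([sum_prod_step], [sum_sqr_tent_ge]).  Hence the average of
    sum_i |1 - e(y_i)|^2, weighted by |S|^2, is of order d/h^2, and some y_k lies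
    within 2 sqrt(d)/h of Z^d.

    For the count, Bezout shows that m.p = 0 mod q has at most
    q^(d-1) gcd(m, q) solutions p mod q ([card_congruence_set_le]).  Bounding the
    gcd by the sum of the common divisors e of m and q, and exchanging the sums,
    leaves a factor sum_e e^(-d), which converges because d is at least 2
    ([card_union_congruence_sets]).  The vectors m have entries of order at most
    M = T^(1/d)/r, so this gives at most a constant times
    T^d M^d = T^(d+1) r^(-d) vectors a.

    The denominator of the proportion is at least a constant times T^(d+1): the
    vectors of the cone divisible by e are at most the fraction e^(-(d+1)) of
    all its vectors, and these fractions add up to at most 3/4 for e >= 2
    ([card_primitive_cone_ge]).

    The vanishing statement is the inequality tau <= sqrt(d)/2, which holds
    since L_a contains Z^d. *)

(** * Counting solutions of linear congruences *)

Lemma union_bound {T I : finType} (A : {set T}) (P : pred I) (B : I -> {set T}) :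
  (forall x, x \in A -> exists2 i, P i & x \in B i) ->
  (#|A| <= \sum_(i | P i) #|B i|)%N.
Proof.
move=> AB; rewrite -sum1_card.
apply: (@leq_trans (\sum_(x in A) \sum_(i | P i) (x \in B i))).
  apply: leq_sum => x /AB[i Pi xi].
  by rewrite (bigD1 i)//= xi.
rewrite exchange_big/=; apply: leq_sum => i _.
rewrite -sum1_card big_mkcond [leqRHS]big_mkcond/=; apply: leq_sum => x _.
by case: (x \in A); case: (x \in B i).
Qed.

Lemma bezout_big {d : nat} (m : 'I_d -> int) (q : nat) :
  exists u : 'I_d -> int,
    (\sum_j u j * m j = (\big[gcdn/q]_j absz (m j))%:Z %[mod q])%Z.
Proof.
elim: d m => [|d IH] m.
  by exists (fun=> 0); rewrite !big_ord0 modzz mod0z.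
have [u uP] := IH (fun j => m (lift ord0 j)).
set g := \big[gcdn/q]_j absz (m (lift ord0 j)) in uP *.
have [a [b ab]] := Bezoutz (m ord0) g%:Z.
exists (fun j => if unlift ord0 j is Some j' then b * u j' else a).
rewrite !big_ord_recl unlift_none -/g.
have -> : (gcdn `|m ord0|%N g)%:Z = gcdz (m ord0) g by [].
rewrite -ab; apply/eqP; rewrite eqz_modDl; apply/eqP.
under eq_bigr do rewrite liftK -mulrA.
by rewrite -mulr_sumr -modzMmr uP modzMmr.
Qed.

Lemma sum_inv_sqr {R : realFieldType} (n : nat) :
  \sum_(2 <= e < n.+1) (e%:R ^- 2) <= 3 / 4 :> R.
Proof.
(* The induction needs the telescoping bound 1/4 + 1/(2 3) + ... + 1/(n (n-1)). *)
suff H k : \sum_(2 <= e < k.+3) (e%:R ^- 2) <= 3 / 4 - k.+2%:R^-1 :> R.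
  case: n => [|[|n]]; [by rewrite big_geq //; lra|by rewrite big_geq //; lra|].
  by apply: le_trans (H n) _; rewrite lerBlDr lerDl invr_ge0.
elim: k => [|k IH]; first by rewrite big_nat1; lra.
rewrite big_nat_recr//=; apply: le_trans (lerD IH (lexx _)) _.
rewrite -[k.+3]addn1 natrD; set x := k.+2%:R; have x0 : 0 < x :> R by rewrite ltr0n.
rewrite -addrA lerD2l lerNr opprD opprK -subr_ge0.
have -> : x^-1 - (x + 1) ^- 2 - (x+1)^-1 = x^-1 * (x+1)^-2 :> R by field; lra.
rewrite mulr_ge0 ?invr_ge0 ?exprn_ge0; lra.
Qed.

Section Congruence.
Context {d n : nat}.
Notation low := (widen_ord (leqnSn d)).

Definition congruence_set (m : 'I_d -> int) (q : nat) : {set {ffun 'I_d.+1 -> 'I_n.+1}} :=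
  [set f : {ffun 'I_d.+1 -> 'I_n.+1} |
    [&& f ord_max == q :> nat, [forall j, f (low j) < f ord_max]%N &
     (q %| \sum_j m j * (f (low j))%:Z)%Z]].

(** If g is the gcd of q and the m_j, Bezout gives u with m.u = g mod q.  The
    translates of the solution set by t u, for t < q/g, are disjoint since
    m.p takes the value t g on them; so q/g copies of the solution set fit into
    (Z/q)^d. *)
Lemma card_congruence_set_le (m : 'I_d -> int) (q : nat) : (0 < q)%N ->
  (#|congruence_set m q| * q <= q ^ d * \big[gcdn/q]_j absz (m j))%N.
Proof.
move=> q0; set g := \big[gcdn/q]_j _.
have gq : (g %| q)%N.
  by rewrite /g; elim/big_rec: _ => // j x _ xq; exact: dvdn_trans (dvdn_gcdr _ _) xq.
have g0 : (0 < g)%N by exact: dvdn_gt0 gq.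
have [u uP] := bezout_big m q; rewrite -/g in uP.
pose F (x : {ffun 'I_d.+1 -> 'I_n.+1} * 'I_(q %/ g)) : {ffun 'I_d -> 'I_q.-1.+1} :=
  [ffun j => inord (absz (((x.1 (low j))%:Z + x.2%:Z * u j) %% q)%Z)].
suff : (#|setX (congruence_set m q) [set: 'I_(q %/ g)]| <= #|{ffun 'I_d -> 'I_q.-1.+1}|)%N.
  rewrite cardsX cardsT card_ord card_ffun !card_ord prednK// => H.
  by rewrite -[X in (_ * X <= _)%N](divnK gq) mulnA leq_mul2r H orbT.
apply: (@leq_card_in _ _ F) => -[f t] [f' t'].
rewrite !inE/= !andbT => /and3P[/eqP fq /forallP flt fm].
move=> /and3P[/eqP fq' /forallP flt' fm'] /ffunP FF.
have modE j : ((f (low j))%:Z + t%:Z * u j = (f' (low j))%:Z + t'%:Z * u j %[mod q])%Z.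
  have := congr1 val (FF j); rewrite !ffunE/= !inordK; last 2 first.
  - by rewrite prednK//; have := @ltz_pmod ((f' (low j))%:Z + t'%:Z * u j) q; lia.
  - by rewrite prednK//; have := @ltz_pmod ((f (low j))%:Z + t%:Z * u j) q; lia.
  by move=> H; rewrite -[LHS]gez0_abs ?H ?gez0_abs ?modz_ge0//; lia.
have tt : t = t'.
  have sumE (f0 : {ffun 'I_d.+1 -> 'I_n.+1}) (t0 : 'I_(q %/ g)) :
     (q %| \sum_j m j * (f0 (low j))%:Z)%Z ->
     (\sum_j m j * ((f0 (low j))%:Z + t0%:Z * u j) = t0%:Z * g %[mod q])%Z.
    move=> /dvdz_mod0P f0q.
    under eq_bigr do rewrite mulrDr mulrCA [m _ * u _]mulrC.
    by rewrite big_split/= -mulr_sumr -modzDm f0q add0r modz_mod -modzMmr uP modzMmr.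
  have : (t%:Z * g = t'%:Z * g %[mod q])%Z.
    rewrite -(sumE f)// -(sumE f')//; apply/eqP; rewrite eqz_mod_dvd -sumrB.
    apply: rpred_sum => j _; rewrite -mulrBr dvdz_mull// -eqz_mod_dvd; apply/eqP; exact: modE.
  have -> : q%:Z = (q %/ g)%:Z * g%:Z by rewrite -PoszM divnK.
  move/eqP; rewrite eqz_mod_dvd -mulrBl dvdz_mul2r; last by rewrite eqz_nat -lt0n.
  by rewrite -eqz_mod_dvd !modz_nat !modn_small// eqz_nat => /eqP /val_inj.
congr (_, _) => //; apply/ffunP => i; apply/val_inj.
have [j ->|->] := unliftP ord_max i; last by rewrite /= fq fq'.
have -> : lift ord_max j = low j by apply/val_inj; rewrite /= /bump leqNgt ltn_ord.
have := modE j; rewrite tt => /eqP; rewrite eqz_modDr !modz_nat.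
rewrite !modn_small => [/eqP[]//||]; [by have := flt' j; rewrite fq'|by have := flt j; rewrite fq].
Qed.

(** Replacing the gcd by the sum of all the common divisors e makes the bound
    separable in m and q for fixed e. *)
Lemma card_congruence_set_sum (m : 'I_d -> int) (M : nat) (q : nat) :
  (1 < d)%N -> (0 < q <= n)%N -> (forall j, absz (m j) <= M)%N -> (exists j, m j != 0) ->
  (#|congruence_set m q| <= n ^ d.-1 *
     \sum_(e < M.+1 | (0 < e)%N) e * ((e %| q) && [forall j, (e %| absz (m j))%N]))%N.
Proof.
move=> d1 /andP[q0 qn] mM [i mi0]; have := card_congruence_set_le m q q0; set g := \big[gcdn/q]_j _.
have gq : (g %| q)%N.
  by rewrite /g; elim/big_rec: _ => // j x _ xq; exact: dvdn_trans (dvdn_gcdr _ _) xq.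
have gm j : (g %| absz (m j))%N.
  by rewrite /g (bigD1 j)//= dvdn_gcdl.
have g0 : (0 < g)%N by exact: dvdn_gt0 gq.
have gM : (g < M.+1)%N by rewrite ltnS (leq_trans _ (mM i))// dvdn_leq// absz_gt0.
have -> : (q ^ d = q * q ^ d.-1)%N by rewrite -expnS prednK// ltnW.
rewrite -mulnA [(q * _)%N]mulnC leq_pmul2r// => /leq_trans; apply.
apply: leq_mul; first by rewrite leq_exp2r//; lia.
rewrite (bigD1 (Ordinal gM))//= gq.
have -> : [forall j, g %| absz (m j)]%N by apply/forallP.
by rewrite muln1 leq_addr.
Qed.

(** The integers between -M and M, indexed by a finite type. *)
Definition centered {M : nat} (i : 'I_M.*2.+1) : int := i%:Z - M%:Z.

Lemma card_multiples (e : nat) : (0 < e)%N ->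
  (e * #|[set q : 'I_n.+1 | (0 < q)%N && (e %| q)%N]| <= n)%N.
Proof.
move=> e0; set A := [set _ | _].
suff : (#|A| <= n %/ e)%N by rewrite leq_divRL// mulnC.
pose f (q : 'I_n.+1) : 'I_(n %/ e).+1 := inord (q %/ e)%N.
have fE q : f q = (q %/ e)%N :> nat by rewrite /f inordK// ltnS leq_div2r// -ltnS.
rewrite -(card_in_imset (f := f)).
  apply: (@leq_trans #|[set~ (ord0 : 'I_(n %/ e).+1)]|); last by rewrite cardsC1 card_ord.
  apply: subset_leq_card.
  apply/fintype.subsetP => _ /imsetP[q + ->]; rewrite !inE => /andP[q0 eq].
  by rewrite -val_eqE/= fE -lt0n divn_gt0// dvdn_leq.
move=> q q'; rewrite !inE => /andP[_ eq] /andP[_ eq'] /(congr1 val)/=.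
by rewrite !fE => qq; apply/val_inj; rewrite /= -(divnK eq) qq divnK.
Qed.

Lemma card_centered_multiples (M e : nat) : (0 < e <= M)%N ->
  (e * #|[set i : 'I_M.*2.+1 | (e %| absz (centered i))%N]| <= 3 * M)%N.
Proof.
move=> /andP[e0 eM]; set A := [set _ | _].
suff : (#|A| <= (M.*2 %/ e).+1)%N.
  move=> H; apply: leq_trans (leq_mul (leqnn e) H) _.
  have := leq_divM M.*2 e; rewrite mulnS; lia.
rewrite -[leqRHS]card_ord; apply: (@leq_card_in _ _
  (fun i : 'I_M.*2.+1 => inord (i %/ e)%N : 'I_(M.*2 %/ e).+1)).
move=> i i'; rewrite !inE /centered => ei ei' /(congr1 val).
have iM (k : 'I_M.*2.+1) : (k %/ e < (M.*2 %/ e).+1)%N by rewrite ltnS leq_div2r// -ltnS.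
rewrite /= !inordK// => ii; apply/val_inj => /=.
have : (i%:Z == i'%:Z %[mod e])%Z.
  rewrite eqz_mod_dvd; have -> : i%:Z - i'%:Z = (i%:Z - M%:Z) - (i'%:Z - M%:Z) by lia.
  exact: rpredB.
by rewrite (divn_eq i e) (divn_eq i' e) ii !modz_nat !modnMDl !modn_mod eqz_nat => /eqP ->.
Qed.

(** After exchanging the sums, a divisor e contributes e times the number of its
    multiples up to n, which is at most n, times the d-th power of the number
    of its multiples between -M and M. *)
Lemma card_union_congruence_sets_nat (M : nat) (A : {set {ffun 'I_d.+1 -> 'I_n.+1}}) :
  (1 < d)%N ->
  (forall f, f \in A -> (0 < f ord_max)%N /\
     exists m : 'I_d -> int, [/\ forall j, (absz (m j) <= M)%N,
       exists j, m j != 0 & f \in congruence_set m (f ord_max)]) ->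
  (#|A| <= n ^ d *
    \sum_(e < M.+1 | (0 < e)%N)
       #|[set i : 'I_M.*2.+1 | (e %| absz (centered i))%N]| ^ d)%N.
Proof.
move=> d1 AP.
pose vec (mu : {ffun 'I_d -> 'I_M.*2.+1}) j := centered (mu j).
pose P (x : {ffun 'I_d -> 'I_M.*2.+1} * 'I_n.+1) :=
  [exists j, vec x.1 j != 0] && (0 < x.2)%N.
have vecM mu j : (absz (vec mu j) <= M)%N.
  by rewrite /vec /centered; have := ltn_ord (mu j); lia.
have AU : (#|A| <= \sum_(x | P x) #|congruence_set (vec x.1) x.2|)%N.
  apply: union_bound => f /AP[f0 [m [mM [i mi] fm]]].
  pose mu : {ffun 'I_d -> 'I_M.*2.+1} := [ffun j => inord (absz (m j + M%:Z))].
  have vecmu j : vec mu j = m j.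
    by rewrite /vec /centered ffunE inordK; have := mM j; lia.
  exists (mu, f ord_max).
    by rewrite /P/= f0 andbT; apply/existsP; exists i; rewrite vecmu.
  move: fm; rewrite !inE/= => /and3P[-> ->] /=.
  by under eq_bigr do rewrite -vecmu.
apply: leq_trans AU _.
have term x : P x -> (#|congruence_set (vec x.1) x.2| <= n ^ d.-1 *
     \sum_(e < M.+1 | (0 < e)%N) e * ((e %| x.2) && [forall j, (e %| absz (vec x.1 j))%N]))%N.
  move=> /andP[/existsP xi x0]; apply: card_congruence_set_sum => //.
  by rewrite x0 -ltnS ltn_ord.
apply: leq_trans (leq_sum _ term) _.
rewrite -big_distrr/=.
have -> : (n ^ d = n ^ d.-1 * n)%N by rewrite -expnSr prednK// ltnW.
rewrite -mulnA; apply: leq_mul => //.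
rewrite exchange_big big_distrr/=; apply: leq_sum => e e0.
set c := #|_|.
have -> : (c ^ d = \sum_(mu : {ffun 'I_d -> 'I_M.*2.+1}) [forall j, (e %| absz (vec mu j))%N])%N.
  rewrite -[in LHS](card_ord d) -card_ffun_on -sum1_card big_mkcond/=.
  apply: eq_bigr => mu _; case: ifPn.
    by move=> /ffun_onP H; rewrite (introT forallP) // => j; have := H j; rewrite inE.
  move=> H; rewrite (_ : [forall j, _] = false)//; apply: contraNF H => /forallP H.
  by apply/ffun_onP => j; rewrite inE; exact: H.
apply: leq_trans (leq_mul (card_multiples e e0) (leqnn _)).
rewrite -sum1dep_card -mulnA -big_distrr/= leq_mul2l; apply/orP; right.
rewrite mulnC big_distrlr/= pair_big_dep/=.
rewrite big_mkcond [leqRHS]big_mkcond/=; apply: leq_sum => x _.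
rewrite /P muln1; case: [exists _, _] => //=.
by case: (0 < x.2)%N => //=; case: (e %| x.2)%N.
Qed.

Lemma card_union_congruence_sets {R : realFieldType} (M : nat)
    (A : {set {ffun 'I_d.+1 -> 'I_n.+1}}) :
  (1 < d)%N ->
  (forall f, f \in A -> (0 < f ord_max)%N /\
     exists m : 'I_d -> int, [/\ forall j, (absz (m j) <= M)%N,
       exists j, m j != 0 & f \in congruence_set m (f ord_max)]) ->
  #|A|%:R <= 2 * (n%:R ^+ d * (3 * M%:R) ^+ d) :> R.
Proof.
move=> d1 /(card_union_congruence_sets_nat _ _ d1); rewrite -(ler_nat R) => /le_trans; apply.
rewrite natrM natrX mulrCA ler_wpM2l ?exprn_ge0// natr_sum.
apply: (@le_trans _ _ (\sum_(1 <= e < M.+1) (3 * M%:R) ^+ d * e%:R ^- 2)).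
  rewrite big_geq_mkord/=; apply: ler_sum => e e0; rewrite natrX.
  set c := #|_|.
  have : (e * c <= 3 * M)%N by apply: card_centered_multiples; rewrite e0 -ltnS ltn_ord.
  have eR : 1 <= e%:R :> R by rewrite ler1n.
  rewrite -(ler_nat R) !natrM => ec.
  rewrite ler_pdivlMr ?exprn_gt0 ?(lt_le_trans ltr01)//.
  apply: (@le_trans _ _ ((e%:R * c%:R) ^+ d)).
    rewrite exprMn mulrC ler_wpM2r ?exprn_ge0// ler_weXn2l//.
  by rewrite lerXn2r ?nnegrE ?mulr_ge0.
rewrite -mulr_sumr [2 * _]mulrC ler_wpM2l ?exprn_ge0 ?mulr_ge0//.
have := @sum_inv_sqr R M; case: (M) => [|M'].
  by rewrite !big_geq//; lra.
by rewrite [in X in _ -> X]big_ltn//; lra.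
Qed.

End Congruence.

(** * Counting primitive vectors in the cone *)

(** The number b is the ceiling of (b e - x) / e, which recovers b and x. *)
Lemma mul_sub_inj {e b b' x x' : nat} : (x < e)%N -> (x' < e)%N ->
  (0 < b * e)%N -> (0 < b' * e)%N -> (b * e - x = b' * e - x')%N ->
  b = b' /\ x = x'.
Proof.
move=> xe xe' b0 b0'; have [bb|bb|->] := ltngtP b b'.
- by have := leq_mul bb (leqnn e); rewrite mulSn; lia.
- by have := leq_mul bb (leqnn e); rewrite mulSn; lia.
have : (e <= b' * e)%N by rewrite leq_pmull//; case: b' b0'.
by split=> //; lia.
Qed.

Lemma mul_sub_lt {e b b' x x' : nat} : (x' < e)%N ->
  (b * e < b' * e)%N -> (b * e - x < b' * e - x')%N.
Proof.
move=> xe; have e0 : (0 < e)%N by exact: leq_ltn_trans xe.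
by rewrite ltn_pmul2r// => bb; have := leq_mul bb (leqnn e); rewrite mulSn; lia.
Qed.

Section Cone.
Context {d n : nat}.
Notation low := (widen_ord (leqnSn d)).

Definition cone : {set {ffun 'I_d.+1 -> 'I_n.+1}} :=
  [set f : {ffun 'I_d.+1 -> 'I_n.+1} |
     [forall i, (0 < f i)%N] && [forall j, (f (low j) < f ord_max)%N]].

Definition primitive_cone : {set {ffun 'I_d.+1 -> 'I_n.+1}} :=
  [set f in cone | \big[gcdn/0%N]_i (f i : nat) == 1%N].

Lemma coneP (f : {ffun 'I_d.+1 -> 'I_n.+1}) :
  reflect ((forall i, (0 < f i)%N) /\ (forall j, (f (low j) < f ord_max)%N)) (f \in cone).
Proof.
rewrite inE; apply: (iffP andP); move=> [H1 H2].
  by split; apply/forallP.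
by split; apply/forallP.
Qed.

(** Subtracting from each coordinate of e b a remainder less than e stays in the
    cone and is injective in b and the remainders. *)
Lemma card_cone_multiples (e : nat) : (0 < e)%N ->
  (#|[set f in cone | [forall i, (e %| f i)%N]]| * e ^ d.+1 <= #|cone|)%N.
Proof.
move=> e0; set A := [set _ in _ | _].
have -> : (#|A| * e ^ d.+1 = #|setX A [set: {ffun 'I_d.+1 -> 'I_e}]|)%N.
  by rewrite cardsX cardsT card_ffun !card_ord.
pose F (x : {ffun 'I_d.+1 -> 'I_n.+1} * {ffun 'I_d.+1 -> 'I_e}) : {ffun 'I_d.+1 -> 'I_n.+1} :=
  [ffun i => inord (x.1 i - x.2 i)].
have FE x i : F x i = (x.1 i - x.2 i)%N :> nat.
  by rewrite ffunE inordK// (leq_ltn_trans (leq_subr _ _)).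
rewrite -(card_in_imset (f := F)); last first.
  move=> [f r] [f' r']; rewrite !inE/= !andbT.
  move=> /andP[/andP[/forallP f0 _] /forallP ef].
  move=> /andP[/andP[/forallP f0' _] /forallP ef'] /ffunP FF.
  have key i : f i = f' i :> nat /\ r i = r' i :> nat.
    have := congr1 val (FF i); rewrite /= !FE/=.
    have := ltn_ord (r i); have := ltn_ord (r' i); have := f0 i; have := f0' i.
    have /dvdnP[b ->] := ef i; have /dvdnP[b' ->] := ef' i.
    move=> b0 b0' re re' H; by have [-> ->] := mul_sub_inj re' re b0' b0 H.
  by congr (_, _); apply/ffunP => i; apply/val_inj; case: (key i).
apply/subset_leq_card/fintype.subsetP => _ /imsetP[[f r] + ->]; rewrite inE/= in_setT andbT.
rewrite inE => /andP[/coneP[f0 flt] /forallP ef]; apply/coneP; split=> [i|j]; rewrite !FE/=.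
  by rewrite subn_gt0 (leq_trans (ltn_ord (r i)))// dvdn_leq.
have := flt j; have /dvdnP[b ->] := ef (low j); have /dvdnP[b' ->] := ef ord_max.
exact: mul_sub_lt.
Qed.

Lemma card_primitive_cone_ge {R : realFieldType} : (0 < d)%N ->
  #|cone|%:R <= 4 * #|primitive_cone|%:R :> R.
Proof.
move=> d0; pose B e := [set f in cone | [forall i, (e %| f i)%N]].
have decomp : (#|cone| <= #|primitive_cone| + \sum_(2 <= e < n.+1) #|B e|)%N.
  rewrite -(setID cone primitive_cone); apply: (leq_trans (leq_card_setU _ _)).
  apply: leq_add; first by rewrite subset_leq_card// subsetIr.
  rewrite big_geq_mkord/=; apply: union_bound => f.
  rewrite in_setD inE negb_and => /andP[fnp fc]; move: fnp; rewrite fc/= => fnp.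
  have /coneP[f0 _] := fc; set g := \big[gcdn/0%N]_i (f i : nat) in fnp.
  have gf i : (g %| f i)%N by exact: (biggcdn_inf i).
  have gn : (g < n.+1)%N by rewrite (leq_ltn_trans _ (ltn_ord (f ord_max)))// dvdn_leq.
  exists (Ordinal gn); first by have := dvdn_gt0 (f0 ord_max) (gf ord_max) => /=; lia.
  by rewrite inE fc/=; apply/forallP.
have : \sum_(2 <= e < n.+1) #|B e|%:R <= 3 / 4 * #|cone|%:R :> R.
  apply: (@le_trans _ _ (\sum_(2 <= e < n.+1) e%:R ^- 2 * #|cone|%:R)).
    rewrite !big_geq_mkord/=; apply: ler_sum => e e2.
    have eR : 1 <= e%:R :> R by rewrite ler1n ltnW.
    rewrite mulrC ler_pdivlMr ?exprn_gt0 ?(lt_le_trans ltr01)//.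
    have := card_cone_multiples e (ltnW e2); rewrite -(ler_nat R) natrM natrX.
    by apply: le_trans; rewrite ler_wpM2l// ler_weXn2l.
  by rewrite -mulr_suml ler_wpM2r// sum_inv_sqr.
by move: decomp; rewrite -(ler_nat R) natrD natr_sum; lra.
Qed.

Lemma card_cone_ge : (n./2 ^ d.+1 <= #|cone|)%N.
Proof.
set h := n./2.
pose F (f : {ffun 'I_d.+1 -> 'I_h}) : {ffun 'I_d.+1 -> 'I_n.+1} :=
  [ffun i => inord ((i == ord_max) * h + (f i).+1)].
have FE f i : F f i = ((i == ord_max) * h + (f i).+1)%N :> nat.
  rewrite ffunE inordK// ltnS; apply: (@leq_trans (h + h)); last by rewrite /h; lia.
  by apply: leq_add; [case: (_ == _); rewrite ?mul1n ?mul0n|exact: ltn_ord].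
have -> : (h ^ d.+1 = #|F @: setT|)%N.
  rewrite card_imset ?cardsT ?card_ffun ?card_ord// => f f' /ffunP FF.
  by apply/ffunP => i; apply/val_inj; have := congr1 val (FF i); rewrite /= !FE => /addnI [].
apply/subset_leq_card/fintype.subsetP => _ /imsetP[f _ ->].
apply/coneP; split=> [i|j]; rewrite !FE ?eqxx; first lia.
rewrite -val_eqE/= (ltn_eqF (ltn_ord j)) mul0n add0n mul1n addnS ltnS.
exact: leq_trans (ltn_ord _) (leq_addr _ _).
Qed.

End Cone.

(** * Trigonometric preliminaries *)

(** Between 1/4 and 1/2 the right-hand side is at least 1.  Doubling u multiplies
    1 - cos by at most 4, since 1 - cos (2 v) = 2 (1 - cos v) (1 + cos v), and
    it multiplies the left-hand side by exactly 4; so smaller u reduce to that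
    interval. *)
Lemma one_sub_cos_ge {R : realType} (t : R) :
  0 <= t <= 1 / 2 -> 4 * t ^+ 2 <= 1 - cos (t * (pi *+ 2)).
Proof.
have := pi_gt0 R; set P := pi => pi0.
have base (u : R) : 1 / 4 <= u <= 1 / 2 -> 4 * u ^+ 2 <= 1 - cos (u * (pi *+ 2)).
  move=> /andP[u1 u2].
  have : 0 <= cos (u * (pi *+ 2) - pi).
    apply: cos_ge0_pihalf; rewrite -/P (mulr2n P) mulrDr; apply/andP; split; nra.
  rewrite cosB cospi sinpi; nra.
have step n : forall u : R, 1 / 4 <= u * 2 ^+ n -> 0 <= u <= 1 / 2 ->
    4 * u ^+ 2 <= 1 - cos (u * (pi *+ 2)).
  elim: n => [|n IH] u un /andP[u0 u1]; first by
    apply: base; rewrite -[X in _ <= X <= _]mulr1 un mulr1.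
  have [u4|u4] := lerP (1 / 4) u; first by apply: base; rewrite u4.
  have := IH (u * 2); rewrite -mulrA -exprS => /(_ un) H.
  have {}H : 4 * (u * 2) ^+ 2 <= 1 - cos (u * 2 * (pi *+ 2)) by apply: H; lra.
  have E : u * 2 * (pi *+ 2) = u * (pi *+ 2) *+ 2 by ring.
  move: H; rewrite E cos_mulr2n.
  have := cos_le1 (u * (pi *+ 2)); have := cos_geN1 (u * (pi *+ 2)).
  rewrite -mulr_natr; set c := cos _; nra.
move=> /andP[t0 t1]; have [->|tn0] := eqVneq t 0.
  by rewrite mul0r cos0 expr0n mulr0 subrr.
have tp : 0 < t by rewrite lt_neqAle eq_sym tn0.
apply: (step (Num.Def.archi_bound (1 / 4 / t))) => //; last by rewrite t0.
have := @upper_nthrootP R (1 / 4 / t) _ (leqnn _).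
by rewrite ltr_pdivrMr// (mulrC _ t) => /ltW.
Qed.

Lemma periodic_turnD {R : realType} (f : R -> R) (t : R) (z : int) :
  periodic f (pi *+ 2) ->
  f ((t + z%:~R) * (pi *+ 2)) = f (t * (pi *+ 2)).
Proof.
move=> fP; have nat_case n (u : R) : f ((u + n%:R) * (pi *+ 2)) = f (u * (pi *+ 2)).
  by rewrite mulrDl mulr_natl (periodicn fP).
case: z => n; first exact: nat_case.
by rewrite -[LHS](nat_case n.+1) NegzE mulrNz subrK.
Qed.

Lemma norm_sub_round_le {R : realType} (t : R) :
  `|t - (Num.floor (t + 1 / 2))%:~R| <= 1 / 2.
Proof.
have := floor_le (t + 1 / 2); have := floorD1_gt (t + 1 / 2); rewrite intrD.
by set z := (_ %:~R); rewrite ler_norml => h1 h2; apply/andP; split; lra.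
Qed.

Lemma ex_round_one_sub_cos_ge {R : realType} (t : R) :
  exists z : int, 4 * (t - z%:~R) ^+ 2 <= 1 - cos (t * (pi *+ 2)).
Proof.
exists (Num.floor (t + 1 / 2)); have := norm_sub_round_le t.
set z := Num.floor _; rewrite -(periodic_turnD _ t (- z) (@cosD2pi R)) mulrNz ler_norml.
move=> /andP[]; set u := t - z%:~R => u1 u2.
have [u0|u0] := lerP 0 u; first by apply: one_sub_cos_ge; rewrite u0.
by rewrite -(sqrrN u) -cosN -mulNr; apply: one_sub_cos_ge; lra.
Qed.

(** The sums C of cosines and D of sines are invariant under the rotation by the
    common difference b, because the progression closes up after q steps.  A
    nontrivial rotation fixes only the origin. *)
Lemma sum_cos_arith {R : realType} (q : nat) (h : int) (a : R) :
  (0 < q)%N -> ~~ (q %| h)%Z ->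
  \sum_(k < q) cos (a + k%:R * (h%:~R / q%:R * (pi *+ 2))) = 0.
Proof.
move=> q0 qh; set b := h%:~R / q%:R * (pi *+ 2).
have q0R : q%:R != 0 :> R by rewrite pnatr_eq0 -lt0n.
have cb : cos b != 1.
  have [z hz] := ex_round_one_sub_cos_ge (h%:~R / q%:R : R).
  apply/eqP => c1; move: hz; rewrite -/b c1 subrr => hz.
  have : h%:~R / q%:R - z%:~R = 0 :> R.
    by apply/eqP; rewrite -sqrf_eq0 eq_le sqr_ge0 andbT; lra.
  move/eqP; rewrite subr_eq0 => /eqP hq.
  move/negP: qh; apply; apply/dvdzP; exists z.
  by apply/eqP; rewrite -(eqr_int R) intrM -hq divfK.
set C := \sum_(k < q) _.
pose D := \sum_(k < q) sin (a + k%:R * b).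
have shift (F : R -> R) : F (a + q%:R * b) = F a ->
    \sum_(k < q) F (a + k%:R * b + b) = \sum_(k < q) F (a + k%:R * b).
  move=> Fq; have /eqP : \sum_(k < q) F (a + k.+1%:R * b) - \sum_(k < q) F (a + k%:R * b) = 0.
    rewrite -sumrB -(big_mkord xpredT (fun k => F (a + k.+1%:R * b) - F (a + k%:R * b))).
    by rewrite telescope_sumr// Fq mul0r addr0 subrr.
  rewrite subr_eq0 => /eqP <-; apply: eq_bigr => k _; congr F.
  by rewrite -natr1 mulrDl mul1r addrA.
have turnq (F : R -> R) : periodic F (pi *+ 2) -> F (a + q%:R * b) = F a.
  move=> FP; have pi0 : pi *+ 2 != 0 :> R by rewrite mulrn_eq0/= gt_eqF// pi_gt0.
  have -> : a + q%:R * b = (a / (pi *+ 2) + h%:~R) * (pi *+ 2).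
    by rewrite mulrDl divfK// /b mulrA mulrCA divff// mulr1.
  by rewrite periodic_turnD// divfK.
have C_rot : C = C * cos b - D * sin b.
  rewrite {1}/C -(shift cos) ?turnq//; last exact: (@cosD2pi R).
  rewrite /C /D !mulr_suml -sumrB; apply: eq_bigr => k _; exact: cosD.
have D_rot : D = D * cos b + C * sin b.
  rewrite {1}/D -(shift sin) ?turnq//; last exact: (@sinD2pi R).
  rewrite /C /D !mulr_suml -big_split/=; apply: eq_bigr => k _; exact: sinD.
have : (2 * (1 - cos b)) * C = 0.
  have -> : 2 * (1 - cos b) = (1 - cos b) ^+ 2 + sin b ^+ 2 by rewrite sin2cos2; ring.
  have : (1 - cos b) * C = - D * sin b by rewrite mulrBl mul1r {1}C_rot; ring.
  have : (1 - cos b) * D = C * sin b by rewrite mulrBl mul1r {1}D_rot; ring.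
  move=> h1 h2; rewrite mulrDl expr2 -mulrA h2; rewrite mulrA mulrN mulNr h1; ring.
by move/eqP; rewrite !mulf_eq0 pnatr_eq0/= subr_eq0 eq_sym (negbTE cb)/= => /eqP.
Qed.

(** Parseval's identity, in real coordinates. *)
Lemma sum_energy_orthogonal {R : realType} (I : finType) (q : nat)
    (phi : 'I_q -> I -> R) (b : I -> R) :
  (forall i j, i != j -> \sum_(k < q) cos (phi k i - phi k j) = 0) ->
  \sum_(k < q) ((\sum_i b i * cos (phi k i)) ^+ 2 +
                (\sum_i b i * sin (phi k i)) ^+ 2) = q%:R * \sum_i b i ^+ 2.
Proof.
move=> orth.
transitivity (\sum_i \sum_j b i * b j * \sum_(k < q) cos (phi k i - phi k j)).
  under [RHS]eq_bigr do under eq_bigr do rewrite mulr_sumr.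
  under [RHS]eq_bigr do rewrite exchange_big/=.
  rewrite exchange_big/=; apply: eq_bigr => k _.
  rewrite !expr2 !big_distrlr/= -big_split/=; apply: eq_bigr => i _.
  rewrite -big_split/=; apply: eq_bigr => j _.
  by rewrite cosB; ring.
rewrite mulr_sumr; apply: eq_bigr => i _.
rewrite (bigD1 i)//= [X in _ + X]big1; last first.
  by move=> j ji; rewrite orth ?mulr0// eq_sym.
under eq_bigr do rewrite subrr cos0.
rewrite addr0.
by rewrite sumr_const card_ord; ring.
Qed.

(** The identity |(1 - exp (i t)) S|^2 = 2 (1 - cos t) |S|^2 in real
    coordinates: multiplying S by exp (i t) moves its coefficients along s.
    The hypothesis on the phases is only required where c does not vanish, so
    that s may be a cyclic shift of a box of frequencies provided that c
    vanishes on the face where it wraps around. *)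
Lemma shift_energy {R : realType} (I : finType) (s s' : I -> I)
    (phi c : I -> R) (t : R) :
  cancel s s' -> cancel s' s ->
  (forall i, c i != 0 -> phi (s i) = phi i + t) ->
  (\sum_i (c i - c (s' i)) * cos (phi i)) ^+ 2 +
  (\sum_i (c i - c (s' i)) * sin (phi i)) ^+ 2 =
  2 * (1 - cos t) *
  ((\sum_i c i * cos (phi i)) ^+ 2 + (\sum_i c i * sin (phi i)) ^+ 2).
Proof.
move=> sK s'K st.
set A := \sum_i c i * cos _; set B := \sum_i c i * sin _.
have -> : \sum_i (c i - c (s' i)) * cos (phi i) = A - (A * cos t - B * sin t).
  under eq_bigr do rewrite mulrBl.
  rewrite sumrB; congr (_ - _).
  rewrite (reindex s)/=; last by exists s' => i _; [exact: sK|exact: s'K].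
  rewrite !mulr_suml -sumrB; apply: eq_bigr => i _; rewrite sK.
  have [->|/st->] := eqVneq (c i) 0; first by rewrite !mul0r subrr.
  by rewrite cosD; ring.
have -> : \sum_i (c i - c (s' i)) * sin (phi i) = B - (B * cos t + A * sin t).
  under eq_bigr do rewrite mulrBl.
  rewrite sumrB; congr (_ - _).
  rewrite (reindex s)/=; last by exists s' => i _; [exact: sK|exact: s'K].
  rewrite !mulr_suml -big_split/=; apply: eq_bigr => i _; rewrite sK.
  have [->|/st->] := eqVneq (c i) 0; first by rewrite !mul0r addr0.
  by rewrite sinD; ring.
have := sin2cos2 t; set u := sin t; set v := cos t => uv.
have -> : (A - (A * v - B * u)) ^+ 2 + (B - (B * v + A * u)) ^+ 2 =
   ((1 - v) ^+ 2 + u ^+ 2) * (A ^+ 2 + B ^+ 2) by ring.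
by rewrite uv; ring.
Qed.

(** It vanishes at both ends 0 and 2h, as the cyclic shift demands, has slope at
    most 1, and its square sum is of the order of h^3: the discrete analogue of
    a function with small Dirichlet energy. *)
Definition tent (h l : nat) : nat := minn l (h.*2 - l).

Lemma sum_sqr_tent_ge (h : nat) : (h ^ 3 <= 3 * \sum_(l < h.*2.+1) tent h l ^ 2)%N.
Proof.
have -> : (h.*2.+1 = h.+1 + h)%N by lia.
rewrite big_split_ord/=; apply: (@leq_trans (3 * \sum_(l < h.+1) l ^ 2)).
  elim: h => [|h IH]; first by rewrite big_ord_recl/= big_ord0.
  by rewrite big_ord_recr/= mulnDr; move: IH; set S := (\sum_(_ < _) _)%N => IH; nia.
rewrite leq_mul2l/= (leq_trans _ (leq_addr _ _))//.
apply: leq_sum => l _; rewrite leq_sqr /tent; have := ltn_ord l; lia.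
Qed.

Lemma tent_step (h : nat) (l : 'I_h.*2.+1) :
  `|(tent h l)%:R - (tent h (ord_pred l))%:R : int| <= 1.
Proof.
rewrite /tent/=; case: l => -[|l] hl /=.
  by rewrite modn_small// subnn minn0 min0n.
rewrite addnC modnDl modn_small; last exact: ltnW.
rewrite !natz; lia.
Qed.

Definition step_coord {d N} (i : 'I_d) (f : 'I_N -> 'I_N) (J : {ffun 'I_d -> 'I_N}) :
    {ffun 'I_d -> 'I_N} :=
  [ffun j => if j == i then f (J j) else J j].

Lemma sum_prod_step {R : realType} {d N : nat} (i : 'I_d) (s : 'I_N -> 'I_N) (c : 'I_N -> R) :
  \sum_(J : {ffun 'I_d -> 'I_N})
     (\prod_j c (J j) - \prod_j c (step_coord i s J j)) ^+ 2 =
  (\sum_l (c l - c (s l)) ^+ 2) * (\sum_l c l ^+ 2) ^+ d.-1.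
Proof.
pose F j l := (if j == i then c l - c (s l) else c l) ^+ 2.
transitivity (\prod_j \sum_l F j l).
  rewrite bigA_distr_bigA/=; apply: eq_bigr => J _.
  rewrite prodrXl; congr (_ ^+ 2).
  rewrite (bigD1 i)//= [X in _ - X](bigD1 i)//= [RHS](bigD1 i)//= !ffunE eqxx mulrBl.
  congr (_ * _ - _ * _); apply: eq_bigr => j /negbTE ji; rewrite ?ffunE ji//.
rewrite (bigD1 i)//= /F eqxx; congr (_ * _).
under eq_bigr => j /negbTE ji do rewrite ji.
by rewrite prodr_const -[in RHS](card_ord d) (cardC1 i).
Qed.

(** Otherwise sum_i 2 (1 - cos (2 pi y_i)) would be greater than 32 d / h^2 at
    all the points y_k.  Let W be the square sum of the tent and E k the energy
    at y_k of the tent polynomial.  Weighted by E k, that quantity sums up over k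
    to the energies of the discrete derivatives, by Parseval at most
    d q (2h + 1) W^(d-1), while E itself sums up to q W^d.  As W >= h^3 / 3,
    this is impossible. *)
Lemma close_lattice_point {R : realType} (d h q : nat) (p : 'I_d -> nat) (x : 'I_d -> R) :
  (0 < h)%N -> (0 < q)%N ->
  (forall m : 'I_d -> int, (forall j, `|m j| <= h.*2%:Z) ->
     (q %| \sum_j m j * (p j)%:Z)%Z -> forall j, m j = 0) ->
  exists (k : nat) (z : 'I_d -> int),
    \sum_j (x j - k%:R * ((p j)%:R / q%:R) - (z j)%:~R) ^+ 2 <= 4 * d%:R / h%:R ^+ 2.
Proof.
move=> h0 q0 noshort; apply: contrapT => far.
pose y k j : R := x j - k%:R * ((p j)%:R / q%:R).
have {far} far k : 16 * d%:R / h%:R ^+ 2 < \sum_j (1 - cos (y k j * (pi *+ 2))).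
  have [z zP] := choice (fun j => ex_round_one_sub_cos_ge (y k j)).
  apply: lt_le_trans (ler_sum _ (fun j _ => zP j)); rewrite -mulr_sumr.
  rewrite (_ : 16 = 4 * 4); last by rewrite -natrM.
  rewrite -!mulrA ltr_pM2l// mulrA ltNge; apply/negP => H; apply: far.
  by exists k, z.
pose N := h.*2.+1.
pose I := {ffun 'I_d -> 'I_N}.
pose phi (k : 'I_q) (J : I) : R := (\sum_j (J j)%:R * y k j) * (pi *+ 2).
have orth (J J' : I) : J != J' -> \sum_(k < q) cos (phi k J - phi k J') = 0.
  move=> JJ'; pose m j := (J j)%:Z - (J' j)%:Z.
  have qm : ~~ (q %| \sum_j (- m j) * (p j)%:Z)%Z.
    apply/negP => qm; move/eqP: JJ'; apply; apply/ffunP => j; apply/val_inj.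
    suff /eqP : - m j = 0 by rewrite oppr_eq0 subr_eq0 => /eqP [].
    apply: (noshort (fun i => - m i)) qm _ => i.
    have := ltn_ord (J i); have := ltn_ord (J' i); rewrite /m /N.
    set a := nat_of_ord _; set b := nat_of_ord _; lia.
  apply: etrans (sum_cos_arith _ _ ((\sum_j ((J j)%:R - (J' j)%:R) * x j) * (pi *+ 2)) q0 qm).
  apply: eq_bigr => k _; congr cos; rewrite /phi /y -mulrBl mulrA -mulrDl; congr (_ * _).
  rewrite -sumrB rmorph_sum/= mulr_suml mulr_sumr -big_split/=; apply: eq_bigr => j _.
  by rewrite /m !rmorphM/= rmorphN/= rmorphB/= -!pmulrn; ring.
pose c (l : 'I_N) : R := (tent h l)%:R.
pose cI (J : I) : R := \prod_j c (J j).
pose W := \sum_l c l ^+ 2.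
pose E (k : 'I_q) := (\sum_J cI J * cos (phi k J)) ^+ 2 + (\sum_J cI J * sin (phi k J)) ^+ 2.
have sumE : \sum_(k < q) E k = q%:R * W ^+ d.
  rewrite /E sum_energy_orthogonal//; congr (_ * _).
  under eq_bigr do rewrite -prodrXl.
  rewrite -(bigA_distr_bigA (fun _ l => c l ^+ 2)) prodr_const card_ord//.
have W3 : h%:R ^+ 3 <= 3 * W.
  have := sum_sqr_tent_ge h; rewrite -(ler_nat R) natrX natrM natr_sum => /le_trans; apply.
  rewrite ler_pM2l// ler_sum// => l _; rewrite natrX lexx//.
have shiftE i (k : 'I_q) : 2 * (1 - cos (y k i * (pi *+ 2))) * E k =
   (\sum_J (cI J - cI (step_coord i (@ord_pred N) J)) * cos (phi k J)) ^+ 2 +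
   (\sum_J (cI J - cI (step_coord i (@ord_pred N) J)) * sin (phi k J)) ^+ 2.
  rewrite (@shift_energy _ _ (step_coord i (@ordS N)) _ _ _ (y k i * (pi *+ 2)))//.
  - by move=> J; apply/ffunP => j; rewrite !ffunE; case: eqP => // _; rewrite ordSK.
  - by move=> J; apply/ffunP => j; rewrite !ffunE; case: eqP => // _; rewrite ord_predK.
  (* The phase is shifted correctly unless J i wraps around, where the tent is 0. *)
  move=> J cJ; have Jmax : (J i < h.*2)%N.
    rewrite ltnNge; apply/negP => Ji; move/eqP: cJ; apply.
    rewrite /cI (bigD1 i)//= /c /tent (eqP Ji) minn0 mul0r//.
  rewrite /phi -mulrDl; congr (_ * _).
  rewrite (bigD1 i)//= [in RHS](bigD1 i)//= !ffunE eqxx/= modn_small//.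
  rewrite -natr1 mulrDl mul1r addrAC; congr (_ + _ + _).
  by apply: eq_bigr => j /negbTE ji; rewrite ffunE ji.
have hR : 0 < h%:R :> R by rewrite ltr0n.
have qR : 0 < q%:R :> R by rewrite ltr0n.
have d0 : (0 < d)%N.
  rewrite lt0n; apply/eqP => dz; have := far 0%N; rewrite big1 => [|j _].
    by rewrite [X in _ * X%:R / _]dz mulr0 mul0r ltxx.
  by have := ltn_ord j; rewrite [X in (_ < X)%N]dz.
have dR : 0 < d%:R :> R by rewrite ltr0n.
(* The derivative of the tent is at most 1 on each of its N points. *)
have step_le i : \sum_(k < q) 2 * (1 - cos (y k i * (pi *+ 2))) * E k <=
    q%:R * (N%:R * W ^+ d.-1).
  under eq_bigr do rewrite shiftE.
  rewrite sum_energy_orthogonal//.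
  rewrite [X in _ * X](sum_prod_step i (@ord_pred N) c) ler_pM2l// -/W.
  rewrite ler_wpM2r//; first by rewrite exprn_ge0// sumr_ge0// => l _; exact: sqr_ge0.
  apply: (@le_trans _ _ (\sum_(l < N) 1)); last by rewrite sumr_const card_ord.
  apply: ler_sum => l _.
  have : `|c l - c (ord_pred l)| <= 1.
    by have := tent_step h l; rewrite -(ler_int R) intr_norm rmorphB/= !rmorph_nat.
  rewrite ler_norml => /andP[? ?]; nra.
have W0 : 0 < W by have := exprn_gt0 3 hR; lra.
have E0 k : 0 <= E k by rewrite addr_ge0// sqr_ge0.
have lo : 2 * (16 * d%:R / h%:R ^+ 2) * (q%:R * W ^+ d) <=
    \sum_(k < q) \sum_i 2 * (1 - cos (y k i * (pi *+ 2))) * E k.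
  rewrite -sumE mulr_sumr; apply: ler_sum => k _.
  by rewrite -mulr_suml -mulr_sumr ler_wpM2r// ler_pM2l// ltW.
have hi : \sum_(k < q) \sum_i 2 * (1 - cos (y k i * (pi *+ 2))) * E k <=
    d%:R * (q%:R * (N%:R * W ^+ d.-1)).
  rewrite exchange_big/=; apply: (le_trans (ler_sum _ (fun i _ => step_le i))).
  by rewrite sumr_const card_ord [d%:R * _]mulr_natl.
have := le_trans lo hi.
have -> : W ^+ d = W * W ^+ d.-1 by rewrite -exprS prednK.
have -> : 2 * (16 * d%:R / h%:R ^+ 2) * (q%:R * (W * W ^+ d.-1)) =
  d%:R * (q%:R * (32 / h%:R ^+ 2 * W * W ^+ d.-1)) by ring.
rewrite !ler_pM2l// (ler_pM2r (exprn_gt0 d.-1 W0)) mulrAC ler_pdivrMr ?exprn_gt0// => H.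
have Nh : N%:R <= 3 * h%:R :> R by rewrite /N -natrM ler_nat; lia.
have : N%:R * h%:R ^+ 2 <= 3 * h%:R * h%:R ^+ 2 :> R by rewrite ler_wpM2r// exprn_ge0.
have := exprn_gt0 3 hR; move: H W3; rewrite exprS; nra.
Qed.

(** * Covering radii *)

Lemma covering_radius_le {R : realType} {d : nat} (L : set 'rV[R]_d) (s : R) :
  0 < s ->
  (forall x : 'rV[R]_d, exists2 v, L v & \sum_j (x 0 j - v 0 j) ^+ 2 <= s ^+ 2) ->
  covering_radius L <= s.
Proof.
move=> s0 cover; apply: ge_inf; first by exists 0 => t [/ltW].
split=> //; apply/seteqP; split=> // x _.
have [v Lv xv] := cover x.
exists v => //; exists (x - v); last by rewrite addrC subrK.
exists (s^-1 *: (x - v)); last by rewrite scalerA divff ?scale1r// gt_eqF.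
rewrite /unit_ballB /= /euclidean_norm -[leRHS]sqrtr1 ler_wsqrtr//.
under eq_bigr do rewrite !mxE exprMn.
by rewrite -mulr_sumr exprVn mulrC ler_pdivrMr ?mul1r// exprn_gt0.
Qed.

Lemma covering_radius_latticeL_ge0 {R : realType} {d : nat} (a : 'rV[nat]_d.+1) :
  0 <= covering_radius (@latticeL R d a).
Proof.
by apply: lb_le_inf; [exact: (latticeL_cover_has_inf R a).1|move=> s [/ltW]].
Qed.

Lemma covering_radius_latticeL_le {R : realType} {d : nat} (a : 'rV[nat]_d.+1) :
  (0 < d)%N -> covering_radius (@latticeL R d a) <= Num.sqrt d%:R / 2.
Proof.
move=> d0; apply: covering_radius_le => [|x].
  by rewrite divr_gt0// sqrtr_gt0 ltr0n.
pose z : 'rV[int]_d := \row_j Num.floor (x 0 j + 1 / 2).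
exists (map_mx intr z); first by exists z => //; exists 0 => //; rewrite mulr0z addr0.
rewrite exprMn sqr_sqrtr// -[d in leRHS]card_ord mulrC mulr_natr -sumr_const.
apply: ler_sum => j _; rewrite !mxE -[leLHS]real_normK ?num_real//.
rewrite lerXn2r ?nnegrE ?normr_ge0 ?invr_ge0//.
by apply: le_trans (norm_sub_round_le _) _; rewrite div1r.
Qed.

(** An integer vector m has integral inner product with nu a, hence lies in the
    dual lattice of latticeL a, exactly when the last entry of a divides the
    sum below. *)
Definition dual_vector_le {d : nat} (a : 'rV[nat]_d.+1) (M : nat) :=
  exists m : 'I_d -> int, [/\ forall j, (absz (m j) <= M)%N, exists j, m j != 0 &
    (a 0%R ord_max %| \sum_j m j * (a 0%R (widen_ord (leqnSn d) j))%:Z)%Z].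

Lemma covering_radius_dual {R : realType} {d : nat} (h : nat) (a : 'rV[nat]_d.+1) :
  (0 < d)%N -> (0 < h)%N -> (0 < a 0%R ord_max)%N -> ~ dual_vector_le a h.*2 ->
  covering_radius (@latticeL R d a) <= 2 * Num.sqrt d%:R / h%:R.
Proof.
move=> d0 h0 a0 nodual; apply: covering_radius_le => [|x].
  by rewrite divr_gt0 ?ltr0n// mulr_gt0// sqrtr_gt0 ltr0n.
have noshort (m : 'I_d -> int) : (forall j, `|m j| <= h.*2%:Z) ->
    (a 0%R ord_max %| \sum_j m j * (a 0%R (widen_ord (leqnSn d) j))%:Z)%Z ->
    forall j, m j = 0.
  move=> mh md j; apply/eqP; apply: contra_notT nodual => mj.
  by exists m; split=> [i||//]; [have := mh i; lia|exists j].
have [k [z zk]] := close_lattice_point d h _ _ (fun j => x 0 j) h0 a0 noshort.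
exists (map_mx intr (\row_j z j) + nu R a *~ k%:Z); first by exists (\row_j z j) => //; exists k%:Z.
apply: le_trans (_ : _ <= 4 * d%:R / h%:R ^+ 2) _; last first.
  by rewrite !exprMn sqr_sqrtr// exprVn (_ : 2 ^+ 2 = 4)// -natrX.
move: zk; apply: le_trans; apply: ler_sum => j _.
rewrite !mxE -pmulrn [X in _ <= X ^+ 2]addrAC opprD addrA.
by rewrite mulmxnE mxE -[_ *+ k]mulr_natl.
Qed.

Definition row_of_ffun {d n : nat} (f : {ffun 'I_d.+1 -> 'I_n.+1}) : 'rV[nat]_d.+1 :=
  \row_i (f i : nat).

Lemma card_fset_set_row {d n : nat} (A : set 'rV[nat]_d.+1) :
  (forall a, A a -> forall i, (a 0%R i <= n)%N) ->
  #|` fset_set A| = #|[set f : {ffun 'I_d.+1 -> 'I_n.+1} | `[< A (row_of_ffun f) >]]%SET|.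
Proof.
move=> An.
have rowI : injective (@row_of_ffun d n).
  by move=> f f' /rowP ff; apply/ffunP => i; apply/val_inj; have := ff i; rewrite !mxE.
have ArowP a : A a -> exists f : {ffun 'I_d.+1 -> 'I_n.+1}, a = row_of_ffun f.
  move=> /An an; exists [ffun i => inord (a 0 i)].
  by apply/rowP => i; rewrite mxE ffunE inordK// ltnS.
have Afin : finite_set A.
  apply: (@sub_finite_set _ _ ((@row_of_ffun d n) @` [set: {ffun 'I_d.+1 -> 'I_n.+1}])%classic).
    by move=> a /ArowP[f ->]; exists f.
  exact/finite_image/finite_finset.
rewrite cardE -(size_map row_of_ffun); apply: perm_size; apply: uniq_perm.
- exact: fset_uniq.
- by rewrite map_inj_uniq// enum_uniq.
move=> a; rewrite in_fset_set//; apply/idP/idP.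
  move=> /set_mem Aa; have [f af] := ArowP _ Aa; rewrite af; apply: map_f.
  by rewrite mem_enum inE -af; apply/asboolP.
by move=> /mapP[f + ->]; rewrite mem_enum !inE => /asboolP/mem_set.
Qed.

Lemma primitive_inP {R : realType} {d : nat} (T : R) (a : 'rV[nat]_d.+1) : 0 < T ->
  primitive_in T a <->
  [/\ forall i, (0 < a 0%R i)%N, \big[gcdn/0%N]_(i < d.+1) a 0 i = 1%N,
      forall j : 'I_d, (a 0%R (widen_ord (leqnSn d) j) < a 0%R ord_max)%N &
      (a 0%R ord_max <= Num.truncn T)%N].
Proof.
move=> T0; split.
  move=> [[a0 ag] [x [x0 [xlt x1]] xa]].
  have ax i : (a 0 i)%:R = T * x 0 i :> R.
    by have := congr1 (fun m : 'rV[R]_d.+1 => m 0 i) xa; rewrite !mxE.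
  split=> // [j|]; first by rewrite -(ltr_nat R) !ax ltr_pM2l.
  by rewrite truncn_ge_nat ?(ltW T0)// ax ler_piMr// ltW.
move=> [a0 ag alt aT]; split; first by split.
exists (T^-1 *: map_mx (fun k : nat => k%:R) a); last first.
  by rewrite scalerA divff ?scale1r// gt_eqF.
have aT' : (a 0 ord_max)%:R <= T by rewrite -truncn_ge_nat// (ltW T0).
split=> [i|]; first by rewrite !mxE mulr_ge0// invr_ge0 ltW.
split=> [j|]; rewrite !mxE; first by rewrite ltr_pM2l ?invr_gt0// ltr_nat.
by rewrite mulrC ler_pdivrMr// mul1r.
Qed.

(** * The tail estimate *)

Lemma primitive_in_entry_le {R : realType} {d : nat} (T : R) (a : 'rV[nat]_d.+1) i :
  0 < T -> primitive_in T a -> (a 0%R i <= Num.truncn T)%N.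
Proof.
move=> T0 /(primitive_inP _ _ T0)[_ _ alt aT]; apply: leq_trans aT.
have [j ->|->//] := unliftP ord_max i.
apply/ltnW; have -> : lift ord_max j = widen_ord (leqnSn d) j; last exact: alt.
by apply/val_inj; rewrite /= /bump leqNgt ltn_ord.
Qed.

Lemma powR_last_le {R : realType} {d : nat} (T : R) (a : 'rV[nat]_d.+1) :
  0 < T -> primitive_in T a -> (a 0%R ord_max)%:R `^ (d%:R^-1) <= T `^ (d%:R^-1).
Proof.
move=> T0 aT; apply: ge0_ler_powR; rewrite ?invr_ge0 ?nnegrE ?(ltW T0)//.
by rewrite -truncn_ge_nat ?(ltW T0)// primitive_in_entry_le.
Qed.

Lemma primitive_in_row {R : realType} {d : nat} (T : R)
    (f : {ffun 'I_d.+1 -> 'I_(Num.truncn T).+1}) :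
  0 < T -> primitive_in T (row_of_ffun f) <-> f \in primitive_cone.
Proof.
move=> T0; rewrite primitive_inP// [_ \in primitive_cone]inE.
have -> : \big[gcdn/0%N]_(i < d.+1) (row_of_ffun f) 0 i = \big[gcdn/0%N]_i (f i : nat).
  by apply: eq_bigr => i _; rewrite mxE.
split=> [[f0 fg flt _]|/andP[/coneP[f0 flt] /eqP fg]].
  apply/andP; split; last exact/eqP.
  by apply/coneP; split=> [i|j]; [have := f0 i|have := flt j]; rewrite !mxE.
by split=> // [i|j|]; rewrite !mxE// -ltnS.
Qed.

Lemma card_primitive_in {R : realType} {d : nat} (T : R) : 0 < T ->
  #|` fset_set (@primitive_in R d T)| = #|@primitive_cone d (Num.truncn T)|.
Proof.
move=> T0; rewrite (@card_fset_set_row d (Num.truncn T)); last first.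
  by move=> a aT i; exact: primitive_in_entry_le aT.
apply: eq_card => f; rewrite inE.
by apply/asboolP/idP => /(primitive_in_row _ _ T0).
Qed.

(** If there is a primitive vector then T >= 2, which makes T at most four times
    the integer half of its integer part. *)
Lemma ler_pow_card_primitive_in {R : realType} {d : nat} (T : R) : (0 < d)%N -> 1 <= T ->
  (0 < #|` fset_set (@primitive_in R d T)|)%N ->
  T ^+ d.+1 <= 4 ^+ d.+2 * #|` fset_set (@primitive_in R d T)|%:R.
Proof.
move=> d0 T1; have T0 : 0 < T by exact: lt_le_trans T1.
rewrite card_primitive_in//; set n := Num.truncn T => /card_gt0P[f].
rewrite inE => /andP[/coneP[f0 flt] _].
have n2 : (2 <= n)%N.
  rewrite -ltnS; apply: leq_ltn_trans (ltn_ord (f ord_max)).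
  exact: leq_ltn_trans (f0 _) (flt (Ordinal d0)).
have Tn : T <= 4 * n./2%:R.
  apply: (le_trans (ltW (truncnS_gt T))); rewrite -natrM ler_nat -/n; lia.
apply: (@le_trans _ _ ((4 * n./2%:R) ^+ d.+1)).
  by rewrite lerXn2r// nnegrE ?mulr_ge0// ltW.
rewrite exprMn [4 ^+ d.+2]exprSr -mulrA ler_wpM2l ?exprn_ge0//.
apply: le_trans (card_primitive_cone_ge d0).
by rewrite -natrX ler_nat card_cone_ge.
Qed.

Lemma probP_eq0 {R : realType} {d : nat} (T r : R) : (0 < d)%N -> 0 < T ->
  Num.sqrt d%:R / 2 * T `^ (d%:R^-1) < r -> probP d T r = 0.
Proof.
move=> d0 T0 rT; rewrite /probP.
suff -> : [set a : 'rV[nat]_d.+1 | primitive_in T a /\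
       covering_radius (@latticeL R d a) * (a 0 ord_max)%:R `^ (d%:R^-1) > r]%classic
    = classical_sets.set0.
  by rewrite fset_set0 mul0r.
apply/seteqP; split=> // a [aT]; rewrite ltNge => /negP; apply.
apply: le_trans (ltW rT); apply: ler_pM.
- exact: covering_radius_latticeL_ge0.
- exact: powR_ge0.
- exact: covering_radius_latticeL_le.
- exact: powR_last_le.
Qed.

(** By the vanishing statement, only r <= sqrt(d)/2 T^(1/d) matters.  The scale h
    is the least integer above 2 sqrt(d) T^(1/d) / r.  It depends on T and r
    only, and it is so large that the absence of dual vectors with entries at
    most 2h would give a covering radius below r T^(-1/d), by
    [covering_radius_dual]; so every counted a has such a dual vector.  The bound
    on r makes h at most 3 sqrt(d) T^(1/d) / r. *)
Lemma probP_le {R : realType} {d : nat} (T r : R) : (1 < d)%N -> 1 <= T -> 0 < r ->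
  probP d T r <= 2 * 4 ^+ d.+2 * (18 * Num.sqrt d%:R) ^+ d * r ^- d.
Proof.
move=> d1 T1 r0; have d0 : (0 < d)%N by exact: ltnW.
have T0 : 0 < T by exact: lt_le_trans T1.
have rhs0 : 0 <= 2 * 4 ^+ d.+2 * (18 * Num.sqrt d%:R) ^+ d * r ^- d.
  have s0 : 0 <= Num.sqrt d%:R :> R by exact: sqrtr_ge0.
  apply: mulr_ge0; last by rewrite invr_ge0 exprn_ge0// ltW.
  apply: mulr_ge0; last by rewrite exprn_ge0// mulr_ge0.
  by apply: mulr_ge0; last rewrite exprn_ge0.
have [rT|rT] := ltP (Num.sqrt d%:R / 2 * T `^ (d%:R^-1)) r; first by rewrite probP_eq0.
rewrite /probP; set A := (X in fset_set X).
have [->|prim0] := posnP #|` fset_set (@primitive_in R d T)|; first by rewrite invr0 mulr0.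
rewrite ler_pdivrMr ?ltr0n//.
set s := Num.sqrt d%:R in rT rhs0 *; set t := T `^ (d%:R^-1) in rT *.
have s0 : 0 < s by rewrite sqrtr_gt0 ltr0n.
have t0 : 0 < t by exact: powR_gt0.
have td : t ^+ d = T.
  by rewrite -powR_mulrn ?ltW// -powRrM mulVf ?powRr1 ?ltW// pnatr_eq0 -lt0n.
pose h := (Num.truncn (2 * s * t / r)).+1.
have h_gt : 2 * s * t / r < h%:R by exact: truncnS_gt.
have h_le : h%:R <= 3 * s * t / r.
  have x0 : 0 <= 2 * s * t / r by rewrite ltW// divr_gt0// !mulr_gt0.
  have : (Num.truncn (2 * s * t / r))%:R <= 2 * s * t / r by rewrite -truncn_ge_nat.
  rewrite /h -natr1; have : 2 <= s * t / r by rewrite ler_pdivlMr//; lra.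
  by rewrite -!mulrA; lra.
have numer : #|` fset_set A|%:R <= 2 * ((Num.truncn T)%:R ^+ d * (3 * h.*2%:R) ^+ d) :> R.
  rewrite (@card_fset_set_row d (Num.truncn T)); last first.
    by move=> a [aT _] i; exact: primitive_in_entry_le aT.
  apply: card_union_congruence_sets => // f; rewrite inE => /asboolP[fT fr].
  have /primitive_in_row : primitive_in T (row_of_ffun f) by [].
  move=> /(_ T0); rewrite inE => /andP[/coneP[f0 flt] _]; split=> //.
  have : dual_vector_le (row_of_ffun f) h.*2.
    apply: contrapT => /(covering_radius_dual _ _ d0 (ltn0Sn _)) H.
    have {}H := H R; rewrite mxE in H; have {}H := H (f0 _).
    move: fr; rewrite ltNge => /negP; apply.
    apply: (@le_trans _ _ (2 * s / h%:R * t)).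
      apply: ler_pM H _; [exact: covering_radius_latticeL_ge0|exact: powR_ge0|].
      exact: powR_last_le.
    by rewrite mulrAC ler_pdivrMr ?ltr0n// (mulrC r) -ler_pdivrMr// ltW.
  move=> [m [mh m0 md]]; exists m; split=> //.
  rewrite inE eqxx/=; apply/andP; split; first exact/forallP.
  move: md; rewrite mxE; congr (_ %| _)%Z.
  by apply: eq_bigr => j _; rewrite mxE.
apply: (le_trans numer).
apply: (@le_trans _ _ (2 * (T ^+ d * ((18 * s) ^+ d * r ^- d * T)))).
  rewrite ler_pM2l//; apply: ler_pM; rewrite ?exprn_ge0//.
    have nT : (Num.truncn T)%:R <= T by rewrite -truncn_ge_nat// ltW.
    by rewrite lerXn2r// nnegrE// ltW.
  rewrite -td -exprVn -!exprMn lerXn2r ?nnegrE ?mulr_ge0 ?invr_ge0 ?(ltW r0) ?(ltW s0) ?(ltW t0)//.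
  by rewrite -muln2 natrM; move: h_le; rewrite -!mulrA; lra.
have := ler_pow_card_primitive_in T d0 T1 prim0.
set N := (#|` _|)%:R; rewrite exprSr => TN.
have -> : 2 * (T ^+ d * ((18 * s) ^+ d * r ^- d * T)) =
  2 * ((18 * s) ^+ d * r ^- d) * (T ^+ d * T) by ring.
have -> : 2 * 4 ^+ d.+2 * (18 * s) ^+ d * r ^- d * N =
  2 * ((18 * s) ^+ d * r ^- d) * (4 ^+ d.+2 * N) by ring.
apply: ler_wpM2l TN.
by rewrite !mulr_ge0 ?exprn_ge0 ?invr_ge0 ?mulr_ge0 ?exprn_ge0// ltW.
Qed.

Theorem theorem4p1 (R : realType) (d : nat) (hd : (2 <= d)%N) :
  (exists C : R, 0 < C /\
     forall T r : R, 1 <= T -> 0 < r -> probP d T r <= C * r ^- d) /\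
  (forall T r : R, 1 <= T -> 0 < r ->
     Num.sqrt d%:R / 2 * T `^ (d%:R^-1) < r -> probP d T r = 0).
Proof.
split; last by move=> T r T1 _; apply: probP_eq0; [exact: ltnW|exact: lt_le_trans T1].
exists (2 * 4 ^+ d.+2 * (18 * Num.sqrt d%:R) ^+ d); split; last first.
  by move=> T r T1 r0; exact: probP_le.
apply: mulr_gt0; first by apply: mulr_gt0; rewrite ?exprn_gt0.
by rewrite exprn_gt0// mulr_gt0// sqrtr_gt0 ltr0n ltnW.
Qed.
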